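(* Let $\mathfrak g=\mathfrak{sl}(3)$ over $\mathbb C$, $\mathfrak n$ its maximal nilpotent subalgebra, and $\mathfrak l_\bullet=\Pi(H^{\bullet+1}(\mathfrak n;\mathfrak n))$. An odd element $x\in\mathfrak l_\bullet$, i.e. $x=x^0+x^2$ with $x^i\in H^i(\mathfrak n;\mathfrak n)$, is homologic (that is, $[x,x]=0$) if and only if one of the following holds: a) $x^0\neq0$ and $x=ah^0_1+bh^2_3+ch^2_5$ with $a\neq0$ and arbitrary $b,c\in\mathbb C$; b) $x^0=0$ and $x=ah^2_1+bh^2_2+ch^2_3+dh^2_4+eh^2_5$ with $a,b,c,d,e\in\mathbb C$ satisfying $ae-bc=0$ and $be+cd=0$.
   Context: The algebra $\mathfrak n$ has basis $e_{1,0},e_{0,1},e_{1,1}$, where $e_{p,q}$ is the root vector (from a Chevalley basis) of the positive root with coordinates $(p,q)$ in the simple roots; the only nonzero bracket of basis vectors (up to antisymmetry) is $[e_{1,0},e_{0,1}]=\pm e_{1,1}$ (either sign). $f^{p,q}$ is the dual basis of $\mathfrak n^*$. $C^k=\mathfrak n\otimes\Lambda^k\mathfrak n^*$ are the cochains with adjoint coefficients, with the Chevalley–Eilenberg differential; $H^k=H^k(\mathfrak n;\mathfrak n)$. Cocycles are identified with their classes. $H^0$ has basis $h^0_1=e_{1,1}$, and $H^2$ has as basis the classes of $h^2_1=e_{0,1}\otimes f^{1,0}\wedge f^{1,1}$; $h^2_2=-e_{0,1}\otimes f^{0,1}\wedge f^{1,1}+e_{1,0}\otimes f^{1,0}\wedge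 f^{1,1}$; $h^2_3=e_{0,1}\otimes f^{0,1}\wedge f^{1,0}-e_{1,1}\otimes f^{1,0}\wedge f^{1,1}$; $h^2_4=e_{1,0}\otimes f^{0,1}\wedge f^{1,1}$; $h^2_5=e_{1,0}\otimes f^{0,1}\wedge f^{1,0}+e_{1,1}\otimes f^{0,1}\wedge f^{1,1}$. For monomials $a=e_\alpha\otimes f^{\beta_1}\wedge\dots\wedge f^{\beta_p}$, $b=e_{\alpha'}\otimes f^{\beta'_1}\wedge\dots\wedge f^{\beta'_q}$ put $$a\cdot b=\sum_{k=1}^{p}(-1)^{p-k}f^{\beta_k}(e_{\alpha'})\,e_\alpha\otimes f^{\beta_1}\wedge\dots\wedge\widehat{f^{\beta_k}}\wedge\dots\wedge f^{\beta_p}\wedge f^{\beta'_1}\wedge\dots\wedge f^{\beta'_q},$$ extended bilinearly, and $[a,b]=a\cdot b-(-1)^{(p-1)(q-1)}b\cdot a$. This makes $\Pi(C^{\bullet+1})$ ($\Pi$ is the change of parity; $C^{k+1}$ sits in degree $k$ with parity $k\bmod2$) a differential graded Lie superalgebra and induces a Lie superalgebra structure on $\mathfrak l_\bullet$, $\mathfrak l_k=\Pi(H^{k+1})$; its odd part is $H^0\oplus H^2$. *)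

(* Defs.v *)
From HB Require Import structures.
From mathcomp Require Import all_boot all_order all_algebra.
From mathcomp Require Import generic_quotient ring_quotient.
From mathcomp Require Import reals complex ring lra zify.

Set Implicit Arguments.
Unset Strict Implicit.
Unset Printing Implicit Defensive.

Import GRing.Theory.
Local Open Scope ring_scope.
Local Open Scope quotient_scope.

(* The positive roots of sl(3) in the simple-root coordinates (p,q), ordered
   (1,0) < (0,1) < (1,1).                                                     *)
Definition r10 : 'I_3 := @Ordinal 3 0 isT.
Definition r01 : 'I_3 := @Ordinal 3 1 isT.
Definition r11 : 'I_3 := @Ordinal 3 2 isT.

(* An element of n (x) Lambda n^* is given by its coefficients in n: the value
   at S is the coefficient of f^{s_1} /\ ... /\ f^{s_k}, where s_1 < ... < s_k
   are the elements of S.                                                     *)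
Notation cochain F := {ffun {set 'I_3} -> 'rV[F]_3}.

Fixpoint inversions (s : seq 'I_3) : nat :=
  if s is i :: s' then (count (fun j : 'I_3 => (j < i)%N) s' + inversions s')%N
  else 0.

Section NilpotentCohomology.

Variables (F : fieldType) (eps : bool).

Definition e (i : 'I_3) : 'rV[F]_3 := delta_mx 0 i.

(* [e_{1,0}, e_{0,1}] = (-1)^eps e_{1,1}: the two values of eps are the two
   possible signs.                                                            *)
Definition lie (x y : 'rV[F]_3) : 'rV[F]_3 :=
  ((-1) ^+ eps * (x 0 r10 * y 0 r01 - x 0 r01 * y 0 r10)) *: e r11.

(* By to_sl3_lie, to_sl3_inj and to_sl3_image below, (n, lie) is isomorphic to
   the strictly upper triangular matrices, e_{1,1} going to (-1)^eps E_{13}.  *)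
Definition to_sl3 (x : 'rV[F]_3) : 'M[F]_3 :=
  x 0 r10 *: delta_mx r10 r01 + x 0 r01 *: delta_mx r01 r11
  + ((-1) ^+ eps * x 0 r11) *: delta_mx r10 r11.

(* f^{s_1} /\ ... /\ f^{s_k} = wsign s * (the sorted wedge of the same f's);
   also the value of that sorted wedge at (e_{s_1}, ..., e_{s_k}).            *)
Definition wsign (s : seq 'I_3) : F :=
  if uniq s then (-1) ^+ inversions s else 0.

(* e_al (x) f^{s_1} /\ ... /\ f^{s_k} *)
Definition monomial (al : 'I_3) (s : seq 'I_3) : cochain F :=
  [ffun S : {set 'I_3} => (if S == [set:: s] then wsign s else 0) *: e al].

(* c(e_{t_1}, ..., e_{t_k}) *)
Definition value (c : cochain F) (t : seq 'I_3) : 'rV[F]_3 :=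
  wsign t *: c [set:: t].

Definition omit (i : nat) (s : seq 'I_3) := take i s ++ drop i.+1 s.

(* Chevalley-Eilenberg differential with adjoint coefficients:
   (dc)(x_0,...,x_k) = \sum_i (-1)^i [x_i, c(..., ^x_i, ...)]
      + \sum_(i<j) (-1)^(i+j) c([x_i,x_j], ..., ^x_i, ..., ^x_j, ...).        *)
Definition CEdiff (c : cochain F) : cochain F :=
  [ffun S : {set 'I_3} =>
   let s := enum S in
   let x i := nth r10 s i in
   \sum_(0 <= i < size s) (-1) ^+ i *: lie (e (x i)) (value c (omit i s))
   + \sum_(0 <= i < size s) \sum_(i.+1 <= j < size s) (-1) ^+ (i + j) *:
       \sum_m (lie (e (x i)) (e (x j))) 0 m *: value c (m :: omit i (omit j s))].

Definition dot_monomial al (s : seq 'I_3) al' (s' : seq 'I_3) : cochain F :=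
  \sum_(0 <= k < size s)
    ((-1) ^+ (size s - k.+1) * (nth r10 s k == al')%:R) *:
      monomial al (omit k s ++ s').

(* (p-1)(q-1) and (p+1)(q+1) have the same parity; the latter avoids the
   truncated predecessor when p or q is 0.                                    *)
Definition bracket_monomial al s al' s' : cochain F :=
  dot_monomial al s al' s'
  - (-1) ^+ ((size s).+1 * (size s').+1) *: dot_monomial al' s' al s.

Definition bracket (a b : cochain F) : cochain F :=
  \sum_al \sum_(S : {set 'I_3}) \sum_al' \sum_(S' : {set 'I_3})
    (a S 0 al * b S' 0 al') *: bracket_monomial al (enum S) al' (enum S').


Definition ords : seq 'I_3 := [:: r10; r01; r11].

Lemma enum_ords : enum 'I_3 = ords.
Proof. by apply: (inj_map val_inj); rewrite val_enum_ord. Qed.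

Lemma ords_in (i : 'I_3) : i \in ords.
Proof. by rewrite -enum_ords mem_enum. Qed.

Lemma sum_ords (V : zmodType) (G : 'I_3 -> V) : \sum_m G m = \sum_(m <- ords) G m.
Proof. by rewrite -enum_ords big_enum. Qed.

Lemma to_sl3E x i j : to_sl3 x i j =
  if (i == r10) && (j == r01) then x 0 r10 else
  if (i == r01) && (j == r11) then x 0 r01 else
  if (i == r10) && (j == r11) then (-1) ^+ eps * x 0 r11 else 0.
Proof.
rewrite !mxE; case: i j => [[|[|[|//]]] ?] [[|[|[|//]]] ?] /=;
  by rewrite ?(mulr0, mulr1, add0r, addr0).
Qed.

Lemma to_sl3_lie x y :
  to_sl3 (lie x y) = to_sl3 x *m to_sl3 y - to_sl3 y *m to_sl3 x.
Proof.
have sgn2 : (-1) ^+ eps * (-1) ^+ eps = 1 :> F by rewrite -expr2 sqrr_sign.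
apply/matrixP => i j; rewrite [RHS]mxE [X in _ = X + _]mxE [X in _ + X]mxE [X in - X]mxE.
rewrite !sum_ords !big_cons !big_nil !to_sl3E !mxE.
case: i j => [[|[|[|//]]] ?] [[|[|[|//]]] ?] /=;
  rewrite ?(mulr0, mulr1, add0r, addr0, mul0r, subr0, oppr0) //.
by rewrite mulrA sgn2 mul1r [y 0 r10 * _]mulrC.
Qed.

Lemma to_sl3_inj : injective to_sl3.
Proof.
move=> x y /matrixP E; apply/rowP => i.
have := (E r10 r01, E r01 r11, E r10 r11); rewrite !to_sl3E /=.
case=> [[E10 E01]] /(mulfI (negbT (signr_eq0 F eps))) E11.
by have := ords_in i; rewrite !inE => /or3P[] /eqP->.
Qed.

Lemma to_sl3_image (A : 'M[F]_3) :
  (exists x, A = to_sl3 x) <-> (forall i j : 'I_3, (j <= i)%N -> A i j = 0).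
Proof.
split=> [[x ->] [[|[|[|//]]] ?] [[|[|[|//]]] ?] //= _|A0]; rewrite ?to_sl3E //.
exists (\row_k if k == r10 then A r10 r01 else
               if k == r01 then A r01 r11 else (-1) ^+ eps * A r10 r11).
apply/matrixP => i j; rewrite to_sl3E !mxE /=.
rewrite mulrA -expr2 sqrr_sign mul1r.
case: ifP => [/andP[/eqP-> /eqP->] //|n1]; case: ifP => [/andP[/eqP-> /eqP->] //|n2].
case: ifP => [/andP[/eqP-> /eqP->] //|n3]; apply: A0.
by case: i j n1 n2 n3 => [[|[|[|//]]] ?] [[|[|[|//]]] ?].
Qed.

Lemma lie_is_linear u : linear (lie u).
Proof.
move=> k v w; rewrite /lie !mxE scalerA -scalerDl; congr (_ *: _); ring.
Qed.
HB.instance Definition _ u :=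
  GRing.isLinear.Build F 'rV[F]_3 'rV[F]_3 *:%R (lie u) (lie_is_linear u).

Lemma value_is_linear t : linear (fun c => value c t).
Proof.
move=> k v w; rewrite /value !ffunE scalerDr; congr (_ + _).
by rewrite !scalerA mulrC.
Qed.

Lemma CEdiff_is_linear : linear CEdiff.
Proof.
move=> k a b; apply/ffunP => S; rewrite !ffunE scalerDr addrACA.
congr (_ + _).
  rewrite scaler_sumr -big_split /=; apply: eq_bigr => i _.
  rewrite value_is_linear linearP scalerDr !scalerA. by rewrite (mulrC k).
rewrite scaler_sumr -big_split /=; apply: eq_bigr => i _.
rewrite scaler_sumr -big_split /=; apply: eq_bigr => j _.
rewrite scalerA (mulrC k) -scalerA -scalerDr; congr (_ *: _).
rewrite scaler_sumr -big_split /=; apply: eq_bigr => m _.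
by rewrite value_is_linear scalerDr !scalerA (mulrC k).
Qed.
HB.instance Definition _ :=
  GRing.isLinear.Build F (cochain F) (cochain F) *:%R CEdiff CEdiff_is_linear.

Lemma bracketDl k a a' b :
  bracket (k *: a + a') b = k *: bracket a b + bracket a' b.
Proof.
rewrite /bracket scaler_sumr -big_split; apply: eq_bigr => al _ /=.
rewrite scaler_sumr -big_split; apply: eq_bigr => S _ /=.
rewrite scaler_sumr -big_split; apply: eq_bigr => al' _ /=.
rewrite scaler_sumr -big_split; apply: eq_bigr => S' _ /=.
by rewrite !ffunE !mxE scalerA -scalerDl; congr (_ *: _); ring.
Qed.

Lemma bracketDr k a b b' :
  bracket a (k *: b + b') = k *: bracket a b + bracket a b'.
Proof.
rewrite /bracket scaler_sumr -big_split; apply: eq_bigr => al _ /=.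
rewrite scaler_sumr -big_split; apply: eq_bigr => S _ /=.
rewrite scaler_sumr -big_split; apply: eq_bigr => al' _ /=.
rewrite scaler_sumr -big_split; apply: eq_bigr => S' _ /=.
by rewrite !ffunE !mxE scalerA -scalerDl; congr (_ *: _); ring.
Qed.

Definition bracketr b a := bracket a b.
HB.instance Definition _ a :=
  GRing.isLinear.Build F (cochain F) (cochain F) *:%R (bracket a)
    (fun k => bracketDr k a).
HB.instance Definition _ b :=
  GRing.isLinear.Build F (cochain F) (cochain F) *:%R (bracketr b)
    (fun k a a' => bracketDl k a a' b).

(* (-1)^(k-1) on C^k, where C^k has degree k-1. *)
Definition signc (a : cochain F) : cochain F :=
  [ffun S : {set 'I_3} => (-1) ^+ #|S|.+1 *: a S].
Lemma signc_is_linear : linear signc.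
Proof.
move=> k a b; apply/ffunP => S; rewrite !ffunE scalerDr !scalerA.
by congr (_ + _); rewrite mulrC.
Qed.
HB.instance Definition _ :=
  GRing.isLinear.Build F (cochain F) (cochain F) *:%R signc signc_is_linear.
Lemma signcK a : signc (signc a) = a.
Proof. by apply/ffunP => S; rewrite !ffunE scalerA -signr_odd -expr2 sqrr_sign scale1r. Qed.

(* CEdiff and bracket have integer structure constants on the monomials. The
   definitions from here to sign_ok recompute them on lists of terms, so that
   the graded Leibniz rule below reduces to a finite check.                   *)
Definition subs : seq (seq 'I_3) :=
  [:: [::]; [:: r10]; [:: r01]; [:: r11]; [:: r10; r01]; [:: r10; r11];
      [:: r01; r11]; [:: r10; r01; r11]].

Lemma enum_sub s : s \in subs -> enum [set:: s] = s.
Proof.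
have -> : enum [set:: s] = filter [in s] ords.
  rewrite -enum_ords {1}/enum_mem enumT; apply: eq_filter => i.
  by rewrite -[LHS]/(i \in [set:: s]) inE.
by move=> sS; apply/eqP; move: s sS; apply/allP; vm_compute.
Qed.

Lemma set_sub (S : {set 'I_3}) : exists2 s, s \in subs & S = [set:: s].
Proof.
exists (filter [in S] ords); last first.
  by apply/setP => i; rewrite inE mem_filter ords_in andbT.
by rewrite /=; case: (r10 \in S); case: (r01 \in S); case: (r11 \in S).
Qed.

Definition seteq (s t : seq 'I_3) := all (fun i => (i \in s) == (i \in t)) ords.
Lemma seteqE (s t : seq 'I_3) : ([set:: s] == [set:: t]) = seteq s t.
Proof.
apply/eqP/allP => [/setP E i _|E]; first by have := E i; rewrite !inE => ->.
by apply/setP => i; rewrite !inE; apply/eqP/E/ords_in.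
Qed.

Definition term := (int * 'I_3 * seq 'I_3)%type.
Definition lin (l : seq term) : cochain F :=
  \sum_(t <- l) t.1.1%:~R *: monomial t.1.2 t.2.
Definition zpow n : int := if odd n then -1 else 1.
Definition zsign s : int := if uniq s then zpow (inversions s) else 0.

Lemma zpowE n : (zpow n)%:~R = (-1) ^+ n :> F.
Proof. by rewrite /zpow -signr_odd; case: (odd n); rewrite ?expr1 ?mulrN1z. Qed.
Lemma zsignE s : (zsign s)%:~R = wsign s.
Proof. by rewrite /zsign /wsign; case: uniq; rewrite ?zpowE. Qed.
Lemma wsign_sub s : s \in subs -> wsign s = 1.
Proof.
by move=> sS; rewrite -zsignE; suff /eqP-> : zsign s == 1; [| move: s sS; apply/allP; vm_compute].
Qed.

Lemma eE i j : e i 0 j = (i == j)%:R.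
Proof. by rewrite mxE eqxx eq_sym. Qed.

Fixpoint coefl (l : seq term) g u : int :=
  if l is t :: l' then
    (if t.1.2 == g then if seteq u t.2 then t.1.1 * zsign t.2 else 0 else 0)
    + coefl l' g u
  else 0.
Lemma coeflE l g u : lin l [set:: u] 0 g = (coefl l g u)%:~R.
Proof.
rewrite /lin; elim: l => [|t l IH]; first by rewrite big_nil ffunE mxE.
rewrite big_cons !ffunE mxE IH /= rmorphD /= !mxE; congr (_ + _).
rewrite seteqE eqxx /= (eq_sym g).
case: eqP => /= _; last by rewrite !mulr0.
by case: seteq; rewrite ?rmorphM /= ?zsignE ?mulr1 ?mul0r ?mulr0.
Qed.

Definition eql l1 l2 :=
  if nilp (l1 ++ l2) then true else
  all (fun g => all (fun u => coefl l1 g u == coefl l2 g u) subs) ords.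
Lemma eqlP l1 l2 : eql l1 l2 -> lin l1 = lin l2.
Proof.
rewrite /eql; case: nilP => [|_ /allP E]; first by case: l1 => //; case: l2.
apply/ffunP => S; apply/rowP => g.
have [u us ->] := set_sub S.
by rewrite !coeflE; have /allP/(_ u us)/eqP-> := E g (ords_in g).
Qed.

Lemma lin_cat l1 l2 : lin (l1 ++ l2) = lin l1 + lin l2.
Proof. by rewrite /lin big_cat. Qed.

Definition scl (c : int) (l : seq term) : seq term :=
  [seq (c * t.1.1, t.1.2, t.2) | t <- l].
Lemma lin_scl c l : lin (scl c l) = c%:~R *: lin l.
Proof.
rewrite /lin /scl big_map scaler_sumr; apply: eq_bigr => t _ /=.
by rewrite scalerA rmorphM.
Qed.

Definition bindl (f : 'I_3 -> seq 'I_3 -> seq term) (l : seq term) : seq term :=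
  flatten [seq (if t.1.1 == 0 then [::] else scl t.1.1 (f t.1.2 t.2)) | t <- l].
Lemma lin_bind (P : pred (seq 'I_3)) (f : 'I_3 -> seq 'I_3 -> seq term)
    (phi : {linear cochain F -> cochain F}) l :
  (forall al s, P s -> phi (monomial al s) = lin (f al s)) ->
  all (fun t => P t.2) l ->
  phi (lin l) = lin (bindl f l).
Proof.
move=> H; elim: l => [|t l IH] /=.
  by move=> _; rewrite /lin /bindl /= !big_nil linear0.
case/andP => Pt Pl.
rewrite /bindl /= lin_cat -IH // {1}/lin big_cons linearP; congr (_ + _).
case: eqP => [->|_]; first by rewrite scale0r /lin big_nil.
by rewrite lin_scl H.
Qed.

Lemma expand (c : cochain F) :
  c = \sum_(S : {set 'I_3}) \sum_al c S 0 al *: monomial al (enum S).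
Proof.
apply/ffunP => S; apply/rowP => g.
have -> : (\sum_(T : {set 'I_3}) \sum_al c T 0 al *: monomial al (enum T)) S 0 g
  = \sum_(T : {set 'I_3}) \sum_al c T 0 al * monomial al (enum T) S 0 g.
  rewrite sum_ffunE summxE; apply: eq_bigr => T _.
  rewrite sum_ffunE summxE; apply: eq_bigr => al _.
  by rewrite ffunE mxE.
rewrite (bigD1 S) //= [X in _ + X]big1 ?addr0 => [|T TS]; last first.
  rewrite big1 // => al _.
  by rewrite ffunE set_enum eq_sym (negPf TS) scale0r mxE mulr0.
rewrite (bigD1 g) //= big1 ?addr0 => [|al alg]; last first.
  by rewrite ffunE !mxE [g == _]eq_sym (negPf alg) ?andbF !mulr0.
rewrite ffunE set_enum eqxx; have [s ss ->] := set_sub S.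
by rewrite enum_sub // wsign_sub // scale1r eE eqxx mulr1.
Qed.

Lemma lieZ u k v : lie u (k *: v) = k *: lie u v.
Proof. by rewrite linearZ. Qed.

Definition zlie (ep : bool) (i al : 'I_3) : int :=
  zpow ep * (((i == r10) && (al == r01))%:R - ((i == r01) && (al == r10))%:R).
Lemma zlieE i al : lie (e i) (e al) = (zlie eps i al)%:~R *: e r11.
Proof.
rewrite /lie /zlie !eE rmorphM /= rmorphB /= zpowE !rmorph_nat /=.
by rewrite -!natrM !mulnb.
Qed.

Definition zval s t : int := if seteq t s then zsign t * zsign s else 0.
Lemma zvalE al s t : value (monomial al s) t = (zval s t)%:~R *: e al.
Proof.
rewrite /value ffunE seteqE /zval; case: seteq; last by rewrite scale0r scaler0.
by rewrite scalerA rmorphM /= !zsignE.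
Qed.

Definition vlin (l : seq (int * 'I_3)) : 'rV[F]_3 := \sum_(c <- l) c.1%:~R *: e c.2.
Definition dc ep al s (T : seq 'I_3) : seq (int * 'I_3) :=
  let x i := nth r10 T i in
  [seq (zpow i * zlie ep (x i) al * zval s (omit i T), r11) | i <- iota 0 (size T)] ++
  flatten [seq flatten [seq [seq
     (zpow (i + j) * (zlie ep (x i) (x j) * (r11 == m)%:R * zval s (m :: omit i (omit j T))), al)
       | m <- ords] | j <- iota i.+1 (size T - i.+1)] | i <- iota 0 (size T)].
Definition dL ep al s : seq term :=
  flatten [seq [seq (c.1, c.2, T) | c <- dc ep al s T & c.1 != 0] | T <- subs].

Lemma dcE al s T : T \in subs -> CEdiff (monomial al s) [set:: T] = vlin (dc eps al s T).
Proof.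
move=> TS; rewrite ffunE enum_sub // /vlin /dc big_cat; congr (_ + _).
  rewrite big_map /index_iota subn0; apply: eq_bigr => i _ /=.
  rewrite zvalE lieZ zlieE !scalerA.
  move: (zlie _ _ _) (zval _ _) => z v; rewrite !intrM zpowE.
  by congr (_ *: _); ring.
rewrite big_flatten big_map /index_iota subn0; apply: eq_bigr => i _.
rewrite big_flatten big_map; apply: eq_bigr => j _.
rewrite big_map scaler_sumr sum_ords; apply: eq_bigr => m _.
rewrite zvalE zlieE mxE eE !scalerA /=.
move: (zlie _ _ _) (zval _ _) => z v; rewrite !intrM zpowE rmorph_nat.
by congr (_ *: _); ring.
Qed.

Lemma monomial_sub al s t : s \in subs -> t \in subs ->
  monomial al s [set:: t] = (t == s)%:R *: e al.
Proof.
move=> ss ts; rewrite ffunE wsign_sub //.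
case: (t =P s) => [->|ts_neq]; first by rewrite eqxx.
case: eqP => // E; case: ts_neq.
by rewrite -(enum_sub ts) E enum_sub.
Qed.

Lemma lin_rows (f : seq 'I_3 -> seq (int * 'I_3)) T : T \in subs ->
  lin (flatten [seq [seq (c.1, c.2, U) | c <- f U & c.1 != 0] | U <- subs]) [set:: T]
  = vlin (f T).
Proof.
move=> TS; rewrite /lin big_flatten big_map sum_ffunE (big_rem T) // -[LHS]/(_ + _).
rewrite [X in _ + X]big_seq [X in _ + X]big1 ?addr0 => [|U]; last first.
  rewrite rem_filter ?mem_filter // => /andP[UT US].
  rewrite sum_ffunE big_map big1 // => c _ /=.
  by rewrite ffunE monomial_sub // eq_sym (negPf UT) scale0r scaler0.
rewrite sum_ffunE big_map big_filter /vlin big_mkcond; apply: eq_bigr => c _ /=.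
case: eqP => [->|_] /=; first by rewrite scale0r.
by rewrite ffunE monomial_sub // eqxx scale1r.
Qed.

Lemma dLE al s : CEdiff (monomial al s) = lin (dL eps al s).
Proof.
by apply/ffunP => S; have [T TS ->] := set_sub S; rewrite dcE // lin_rows.
Qed.

Definition dotL al s be t : seq term :=
  [seq (zpow (size s - k.+1), al, omit k s ++ t)
     | k <- iota 0 (size s) & nth r10 s k == be].
Lemma dotLE al s be t : dot_monomial al s be t = lin (dotL al s be t).
Proof.
rewrite /lin /dotL big_map big_filter big_mkcond /dot_monomial /index_iota subn0.
apply: eq_bigr => k _ /=; rewrite zpowE.
by case: eqP; rewrite ?mulr1 // mulr0 scale0r.
Qed.

Definition brL al s be t : seq term :=
  dotL al s be t ++ scl (- zpow ((size s).+1 * (size t).+1)) (dotL be t al s).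
Lemma brLE al s be t : s \in subs -> t \in subs ->
  bracket (monomial al s) (monomial be t) = lin (brL al s be t).
Proof.
move=> ss ts; rewrite lin_cat lin_scl -!dotLE rmorphN /= zpowE scaleNr.
rewrite -[RHS]/(bracket_monomial al s be t) /bracket.
rewrite (bigD1 al) //= [X in _ + X]big1 ?addr0 => [|g galn]; last first.
  rewrite big1 // => S _; rewrite big1 // => g' _; rewrite big1 // => S' _.
  by rewrite ffunE mxE eE [al == g]eq_sym (negPf galn) mulr0 mul0r scale0r.
rewrite (bigD1 [set:: s]) //= [X in _ + X]big1 ?addr0 => [|S Sn]; last first.
  rewrite big1 // => g' _; rewrite big1 // => S' _.
  by rewrite ffunE (negPf Sn) mxE mul0r mul0r scale0r.
rewrite (bigD1 be) //= [X in _ + X]big1 ?addr0 => [|g galn]; last first.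
  rewrite big1 // => S' _.
  by rewrite [monomial be t _]ffunE [X in _ * X]mxE eE [be == g]eq_sym (negPf galn) mulr0 mulr0 scale0r.
rewrite (bigD1 [set:: t]) //= [X in _ + X]big1 ?addr0 => [|S Sn]; last first.
  by rewrite [X in _ * fun_of_matrix X _ _]ffunE (negPf Sn) scale0r mxE mulr0 scale0r.
by rewrite !ffunE !eqxx !wsign_sub // !scale1r !eE !eqxx mulr1 scale1r !enum_sub.
Qed.

Definition sgL al s : seq term := [:: (zpow (size s).+1, al, s)].
Lemma sgLE al s : s \in subs -> signc (monomial al s) = lin (sgL al s).
Proof.
move=> ss; rewrite /lin big_seq1 /= zpowE; apply/ffunP => S; rewrite !ffunE.
case: eqP => [->|_]; last by rewrite !scale0r !scaler0.
by congr (_ ^+ _ *: _); rewrite cardE enum_sub.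
Qed.

Definition dtable ep := [seq (al, s, dL ep al s) | al <- ords, s <- subs].
Definition leibniz_check ep :=
  let tab := dtable ep in
  all (fun x => all (fun y =>
    eql (bindl (dL ep) (brL x.1.1 x.1.2 y.1.1 y.1.2))
        (bindl (fun g u => brL g u y.1.1 y.1.2) x.2
         ++ bindl (fun g u => bindl (brL g u) y.2) (sgL x.1.1 x.1.2)))
  tab) tab.
Definition sign_check ep := all (fun al => all (fun s =>
    eql (bindl (dL ep) (sgL al s)) (scl (-1) (bindl sgL (dL ep al s)))
    && eql (bindl (dL ep) (dL ep al s)) [::])
  subs) ords.

Lemma leibniz_ok ep : leibniz_check ep.
Proof. by case: ep; vm_compute. Qed.
Lemma sign_ok ep : sign_check ep.
Proof. by case: ep; vm_compute. Qed.

Lemma dL_subs al s : all (fun t : term => t.2 \in subs) (dL eps al s).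
Proof.
apply/allP => t /flattenP[l /mapP[T TS ->]] /mapP[c _ ->]; exact: TS.
Qed.

Lemma leibniz_monomial al s be t : s \in subs -> t \in subs ->
  CEdiff (bracket (monomial al s) (monomial be t)) =
  bracket (CEdiff (monomial al s)) (monomial be t)
  + bracket (signc (monomial al s)) (CEdiff (monomial be t)).
Proof.
move=> ss ts.
have tab g u : u \in subs -> (g, u, dL eps g u) \in dtable eps.
  by move=> us; apply/allpairsP; exists (g, u); rewrite ords_in us.
have /allP/(_ _ (tab al s ss))/allP/(_ _ (tab be t ts))/eqlP := leibniz_ok eps.
rewrite /=.
rewrite lin_cat => E; rewrite brLE //.
rewrite (lin_bind (P := predT) (f := dL eps) (phi := CEdiff)) ?all_predT //; last first.
  by move=> *; exact: dLE.
rewrite {}E !dLE sgLE //; congr (_ + _).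
  rewrite -[RHS]/(bracketr (monomial be t) _).
  rewrite (lin_bind (P := [in subs]) (f := fun g u => brL g u be t)) ?dL_subs //.
  by move=> g u us; exact: brLE.
rewrite -[RHS]/(bracketr (lin (dL eps be t)) _).
rewrite (lin_bind (P := [in subs]) (f := fun g u => bindl (brL g u) (dL eps be t))) //=.
  move=> g u us; rewrite -[LHS]/(bracket (monomial g u) _).
  rewrite (lin_bind (P := [in subs]) (f := brL g u)) ?dL_subs //.
  by move=> g' u' us'; exact: brLE.
by rewrite ss.
Qed.

Lemma cochain_ind (P : cochain F -> Prop) :
  P 0 -> (forall k a b, P a -> P b -> P (k *: a + b)) ->
  (forall al s, s \in subs -> P (monomial al s)) -> forall c, P c.
Proof.
move=> P0 PD Pm c; have PD' a b : P a -> P b -> P (a + b).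
  by move=> Pa; rewrite -[a]scale1r; exact: PD.
rewrite [c]expand; apply: big_ind => // S _; apply: big_ind => // al _.
rewrite -[_ *: _]addr0; apply: (PD) => //; apply: Pm.
by have [s ss ->] := set_sub S; rewrite enum_sub.
Qed.

Lemma leibniz a b : CEdiff (bracket a b) =
  bracket (CEdiff a) b + bracket (signc a) (CEdiff b).
Proof.
elim/cochain_ind: a => [|k a a' IHa IHa'|al s ss].
- have b0 c : bracket 0 c = 0 by exact: (linear0 (bracketr c)).
  by rewrite b0 !linear0 !b0 addr0.
- rewrite bracketDl !CEdiff_is_linear signc_is_linear !bracketDl IHa IHa'.
  by rewrite scalerDr addrACA.
elim/cochain_ind: b => [|k b b' IHb IHb'|be t ts]; last exact: leibniz_monomial.
- by rewrite !linear0 addr0.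
rewrite bracketDr !CEdiff_is_linear !bracketDr IHb IHb'.
by rewrite scalerDr addrACA.
Qed.

Lemma CEdiffB a b : CEdiff (a - b) = CEdiff a - CEdiff b.
Proof. exact: linearB. Qed.
Lemma CEdiffD a b : CEdiff (a + b) = CEdiff a + CEdiff b.
Proof. exact: linearD. Qed.
Lemma CEdiffZ k a : CEdiff (k *: a) = k *: CEdiff a.
Proof. exact: linearZ. Qed.

Lemma signc_CEdiff a : CEdiff (signc a) = - signc (CEdiff a).
Proof.
elim/cochain_ind: a => [|k a a' IHa IHa'|al s ss]; first by rewrite !(linear0, raddf0) ?oppr0.
  rewrite signc_is_linear !CEdiff_is_linear signc_is_linear IHa IHa'.
  by rewrite opprD scalerN.
have /allP/(_ al (ords_in al))/allP/(_ s ss)/andP[/eqlP + _] := sign_ok eps.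
rewrite sgLE // lin_scl mulrN1z scaleN1r dLE.
rewrite (lin_bind (P := predT) (f := dL eps) (phi := CEdiff)) ?all_predT //; last first.
  by move=> *; exact: dLE.
move=> ->; congr (- _).
rewrite (lin_bind (P := [in subs]) (f := sgL) (phi := signc)) ?dL_subs //.
exact: sgLE.
Qed.

Definition cocycles : {vspace cochain F} := lker (linfun CEdiff).
Definition coboundaries : {pred subvs_of cocycles} :=
  fun z => vsval z \in limg (linfun CEdiff).

Lemma cocycleP c : reflect (CEdiff c = 0) (c \in cocycles).
Proof. by rewrite memv_ker lfunE; exact: eqP. Qed.

Lemma coboundaryP z : reflect (exists c, vsval z = CEdiff c) (z \in coboundaries).
Proof.
apply: (iffP idP) => [/memv_imgP[c _ ->]|[c zE]].
  by exists c; rewrite lfunE.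
by rewrite unfold_in zE -(lfunE CEdiff) memv_img ?memvf.
Qed.

Lemma coboundaries_zmod : zmod_closed coboundaries.
Proof.
split; first by apply/coboundaryP; exists 0; rewrite !linear0.
move=> u v /coboundaryP[b ub] /coboundaryP[c vc]; apply/coboundaryP.
by exists (b - c); rewrite CEdiffB -ub -vc linearB.
Qed.
HB.instance Definition _ :=
  GRing.isZmodClosed.Build (subvs_of cocycles) coboundaries coboundaries_zmod.

(* The total cohomology H^*(n;n); its graded pieces are given by in_H below.  *)
Definition cohomology := Quotient.quot coboundaries.
HB.instance Definition _ := GRing.Zmodule.on cohomology.

Definition cls (z : subvs_of cocycles) : cohomology := \pi_cohomology z.

Lemma clsP z w : reflect (cls z = cls w) (z - w \in coboundaries).
Proof. by rewrite (Quotient.idealrBE coboundaries); exact: eqP. Qed.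

Lemma clsK x : cls (repr x) = x.
Proof. exact: reprK. Qed.

Lemma cls_is_zmod_morphism : zmod_morphism cls.
Proof. by move=> z w; rewrite /cls !piE. Qed.
HB.instance Definition _ :=
  GRing.isZmodMorphism.Build _ cohomology cls cls_is_zmod_morphism.

Lemma clsD z w : cls (z + w) = cls z + cls w.
Proof. exact: raddfD. Qed.

Definition scale_cohomology (k : F) (x : cohomology) := cls (k *: repr x).

Lemma scale_cls k z : scale_cohomology k (cls z) = cls (k *: z).
Proof.
apply/clsP; rewrite -scalerBr.
have /clsP/coboundaryP[c E] : cls (repr (cls z)) = cls z by exact: clsK.
by apply/coboundaryP; exists (k *: c); rewrite CEdiffZ -E linearZ.
Qed.

Lemma cohomology_ind (P : cohomology -> Prop) : (forall z, P (cls z)) -> forall x, P x.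
Proof. by move=> Pc x; rewrite -(clsK x). Qed.

Lemma scale_cohomologyA a b x :
  scale_cohomology a (scale_cohomology b x) = scale_cohomology (a * b) x.
Proof. by elim/cohomology_ind: x => z; rewrite !scale_cls scalerA. Qed.
Lemma scale_cohomology1 : left_id 1 scale_cohomology.
Proof. by elim/cohomology_ind => z; rewrite scale_cls scale1r. Qed.
Lemma scale_cohomologyDr : right_distributive scale_cohomology +%R.
Proof.
move=> a; elim/cohomology_ind => z; elim/cohomology_ind => w.
by rewrite -clsD !scale_cls -clsD scalerDr.
Qed.
Lemma scale_cohomologyDl x : {morph scale_cohomology^~ x : a b / a + b}.
Proof.
by elim/cohomology_ind: x => z a b; rewrite !scale_cls -clsD scalerDl.
Qed.
HB.instance Definition _ := GRing.Zmodule_isLmodule.Build F cohomology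
  scale_cohomologyA scale_cohomology1 scale_cohomologyDr scale_cohomologyDl.

Lemma cls_is_scalable : scalable cls.
Proof. by move=> k z; rewrite -scale_cls. Qed.
HB.instance Definition _ :=
  GRing.isScalable.Build F (subvs_of cocycles) cohomology *:%R cls cls_is_scalable.

Lemma bracket0l b : bracket 0 b = 0.
Proof. exact: (linear0 (bracketr b)). Qed.
Lemma bracketBl a a' b : bracket (a - a') b = bracket a b - bracket a' b.
Proof. exact: (linearB (bracketr b)). Qed.

Lemma bracketBr a b b' : bracket a (b - b') = bracket a b - bracket a b'.
Proof. exact: (linearB (bracket a)). Qed.

Lemma signc_cocycle z : z \in cocycles -> CEdiff (signc z) = 0.
Proof. by move=> /cocycleP zZ; rewrite signc_CEdiff zZ linear0 oppr0. Qed.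

Lemma bracket_cocycle z w :
  z \in cocycles -> w \in cocycles -> bracket z w \in cocycles.
Proof.
move=> /cocycleP zZ /cocycleP wZ; apply/cocycleP.
by rewrite leibniz zZ wZ bracket0l linear0 addr0.
Qed.

Definition bracketZ (z w : subvs_of cocycles) : subvs_of cocycles :=
  Subvs (bracket_cocycle (subvsP z) (subvsP w)).

Lemma bracketZ_coboundary z z' w w' :
  cls z = cls z' -> cls w = cls w' -> cls (bracketZ z w) = cls (bracketZ z' w').
Proof.
move=> /clsP/coboundaryP[b zE] /clsP/coboundaryP[c wE].
apply/clsP/coboundaryP; exists (bracket b (vsval w) + bracket (signc (vsval z')) c).
rewrite CEdiffD !leibniz signcK signc_cocycle ?subvsP // bracket0l add0r.
have /cocycleP-> := subvsP w; rewrite linear0 addr0.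
rewrite -zE -wE.
have vB (u v : subvs_of cocycles) : vsval (u - v) = vsval u - vsval v.
  exact: linearB.
by rewrite !vB bracketBl bracketBr addrA subrK.
Qed.

(* The bracket of Pi(H^{*+1}(n;n)), defined on representatives; lbracket_cls
   shows that it does not depend on their choice.                             *)
Definition lbracket (x y : cohomology) : cohomology :=
  cls (bracketZ (repr x) (repr y)).

Lemma lbracket_cls z w : lbracket (cls z) (cls w) = cls (bracketZ z w).
Proof. by apply: bracketZ_coboundary; exact: clsK. Qed.

Definition homogeneous (k : nat) (c : cochain F) : Prop :=
  forall S : {set 'I_3}, #|S| != k -> c S = 0.

Definition in_H (k : nat) (x : cohomology) : Prop :=
  exists2 z : subvs_of cocycles, homogeneous k (vsval z) & x = cls z.

Definition homologic (x : cohomology) : Prop := lbracket x x = 0.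

Lemma lin_cocycle l : eql (bindl (dL eps) l) [::] -> lin l \in cocycles.
Proof.
move=> E; apply/cocycleP.
rewrite (lin_bind (P := predT) (f := dL eps) (phi := CEdiff)) ?all_predT //.
  by rewrite (eqlP E) /lin big_nil.
by move=> *; exact: dLE.
Qed.

Lemma CEdiff_square c : CEdiff (CEdiff c) = 0.
Proof.
elim/cochain_ind: c => [|k a b IHa IHb|al s ss]; first by rewrite !linear0.
  by rewrite !CEdiff_is_linear IHa IHb scaler0 addr0.
apply/cocycleP; rewrite dLE; apply: lin_cocycle.
by have /allP/(_ al (ords_in al))/allP/(_ s ss)/andP[] := sign_ok eps.
Qed.

Definition z0_1 : cochain F := monomial r11 [::].
Definition z2_1 : cochain F := monomial r01 [:: r10; r11].
Definition z2_2 : cochain F :=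
  - monomial r01 [:: r01; r11] + monomial r10 [:: r10; r11].
Definition z2_3 : cochain F :=
  monomial r01 [:: r01; r10] - monomial r11 [:: r10; r11].
Definition z2_4 : cochain F := monomial r10 [:: r01; r11].
Definition z2_5 : cochain F :=
  monomial r10 [:: r01; r10] + monomial r11 [:: r01; r11].

Lemma z0_1_cocycle : z0_1 \in cocycles.
Proof.
suff -> : z0_1 = lin [:: (1, r11, [::])] by apply: lin_cocycle; case: (eps); vm_compute.
by rewrite /lin big_seq1 /= scale1r.
Qed.
Lemma z2_1_cocycle : z2_1 \in cocycles.
Proof.
suff -> : z2_1 = lin [:: (1, r01, [:: r10; r11])].
  by apply: lin_cocycle; case: (eps); vm_compute.
by rewrite /lin big_seq1 /= scale1r.
Qed.
Lemma z2_2_cocycle : z2_2 \in cocycles.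
Proof.
suff -> : z2_2 = lin [:: (-1, r01, [:: r01; r11]); (1, r10, [:: r10; r11])].
  by apply: lin_cocycle; case: (eps); vm_compute.
by rewrite /lin !big_cons big_nil /= mulrN1z scaleN1r scale1r addr0.
Qed.
Lemma z2_3_cocycle : z2_3 \in cocycles.
Proof.
suff -> : z2_3 = lin [:: (1, r01, [:: r01; r10]); (-1, r11, [:: r10; r11])].
  by apply: lin_cocycle; case: (eps); vm_compute.
by rewrite /lin !big_cons big_nil /= mulrN1z scaleN1r scale1r addr0.
Qed.
Lemma z2_4_cocycle : z2_4 \in cocycles.
Proof.
suff -> : z2_4 = lin [:: (1, r10, [:: r01; r11])].
  by apply: lin_cocycle; case: (eps); vm_compute.
by rewrite /lin big_seq1 /= scale1r.
Qed.
Lemma z2_5_cocycle : z2_5 \in cocycles.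
Proof.
suff -> : z2_5 = lin [:: (1, r10, [:: r01; r10]); (1, r11, [:: r01; r11])].
  by apply: lin_cocycle; case: (eps); vm_compute.
by rewrite /lin !big_cons big_nil /= !scale1r addr0.
Qed.

Definition h0_1 : cohomology := cls (Subvs z0_1_cocycle).
Definition h2_1 : cohomology := cls (Subvs z2_1_cocycle).
Definition h2_2 : cohomology := cls (Subvs z2_2_cocycle).
Definition h2_3 : cohomology := cls (Subvs z2_3_cocycle).
Definition h2_4 : cohomology := cls (Subvs z2_4_cocycle).
Definition h2_5 : cohomology := cls (Subvs z2_5_cocycle).

End NilpotentCohomology.

Arguments h0_1 {F eps}.
Arguments h2_1 {F eps}.
Arguments h2_2 {F eps}.
Arguments h2_3 {F eps}.
Arguments h2_4 {F eps}.
Arguments h2_5 {F eps}.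

(* Main.v *)
Require Import Defs.
From HB Require Import structures.
From mathcomp Require Import all_boot all_order all_algebra.
From mathcomp Require Import reals complex ring.

(** Write a class with components in degrees 0 and 2 as
    x = a0 h0_1 + a h2_1 + b h2_2 + c h2_3 + d h2_4 + k h2_5. Since
    cochains of degrees p and q have their bracket in degree p + q - 1, [x, x]
    has a component 2 [x0, x2] of degree 1 and a component [x2, x2] of degree 3,
    where x0 and x2 are the components of x.

    On the standard cocycles, bracket_square computes these components at
    cochain level. In degree 1, bracketing with e_11 removes a factor f^11, so
    h2_1, h2_2 and h2_4 induce three linearly independent endomorphisms of
    n / [n, n], while h2_3 and h2_5 yield the inner derivations - e_11 (x) f^10 and
    e_11 (x) f^01. In degree 3 the result is
      4 (a k - b c) e_01 (x) f^10 /\ f^01 /\ f^11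
      + 4 (b k + c d) e_10 (x) f^10 /\ f^01 /\ f^11.

    Coboundaries in degrees 1 and 3 take their values in the line of e_11
    (CEdiff_offcenter): in degree 1 because [n, n] is that line, in degree 3
    because every 2-form on n is closed, n being unimodular. Hence the class of
    [x, x] vanishes exactly when
      a0 a = a0 b = a0 d = 0,  a k = b c  and  b k + c d = 0
    (homologic_hclass). If a0 is nonzero this says a = b = d = 0, and the two
    quadrics vanish automatically; if a0 = 0 only the quadrics remain.

    That every class of degree 0 or 2 has the form above is linear algebra on
    coordinates (cocycle0_span and cocycle2_span). *)

Import GRing.Theory Num.Theory.
Local Open Scope ring_scope.

Section HomologicElements.

Set Implicit Arguments.
Unset Strict Implicit.
Unset Printing Implicit Defensive.

Variable F : fieldType.

(** * Cochains as combinations of integral term lists *)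

(** Scalars are kept apart from integral lists of monomials: the differential
    and the bracket act on the lists alone, hence by computation, and leave
    only a polynomial identity in the scalars to be checked. *)
Definition comb (kl : seq (F * seq term)) : cochain F :=
  \sum_(p <- kl) p.1 *: lin F p.2.

Lemma comb_nil : comb [::] = 0. Proof. exact: big_nil. Qed.
Lemma comb_cons p kl : comb (p :: kl) = p.1 *: lin F p.2 + comb kl.
Proof. exact: big_cons. Qed.
Lemma comb_cat kl kl' : comb (kl ++ kl') = comb kl + comb kl'.
Proof. exact: big_cat. Qed.

Lemma comb_coord kl u g :
  comb kl [set:: u] 0 g = \sum_(p <- kl) p.1 * (coefl p.2 g u)%:~R.
Proof.
rewrite /comb sum_ffunE summxE; apply: eq_bigr => p _.
by rewrite ffunE mxE coeflE.
Qed.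

Lemma CEdiff_lin eps l : CEdiff eps (lin F l) = lin F (bindl (dL eps) l).
Proof.
apply: (lin_bind (P := predT)); last exact: all_predT.
by move=> *; exact: dLE.
Qed.

Lemma CEdiff_comb eps kl :
  CEdiff eps (comb kl) = comb [seq (p.1, bindl (dL eps) p.2) | p <- kl].
Proof.
elim: kl => [|p kl IH]; first by rewrite comb_nil raddf0.
by rewrite /= !comb_cons CEdiff_is_linear IH CEdiff_lin.
Qed.

Definition lbr (l l' : seq term) :=
  bindl (fun al s => bindl (brL al s) l') l.

(** The lists to whose monomials brLE applies. *)
Definition on_subs (l : seq term) := all (fun t => t.2 \in subs) l.

Lemma bracket_lin l l' : on_subs l -> on_subs l' ->
  bracket (lin F l) (lin F l') = lin F (lbr l l').
Proof.
move=> sl sl'; rewrite -[LHS]/(bracketr (lin F l') _).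
rewrite (lin_bind (P := [in subs]) (f := fun al s => bindl (brL al s) l')) //.
move=> al s ss; rewrite -[LHS]/(bracket (monomial F al s) _).
rewrite (lin_bind (P := [in subs]) (f := brL al s)) // => be t ts.
exact: brLE.
Qed.

Lemma bracket_comb kl kl' :
  all on_subs (unzip2 kl) -> all on_subs (unzip2 kl') ->
  bracket (comb kl) (comb kl') =
  comb [seq (p.1 * q.1, lbr p.2 q.2) | p <- kl, q <- kl'].
Proof.
move=> + skl'; elim: kl => [_|p kl IH /= /andP[sp skl]].
  by rewrite comb_nil bracket0l.
rewrite comb_cons bracketDl comb_cat IH //; congr (_ + _).
elim: kl' skl' {IH} => [_|q kl' IH /= /andP[sq skl']].
  by rewrite comb_nil raddf0 scaler0.
by rewrite !comb_cons bracketDr scalerDr scalerA IH // bracket_lin.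
Qed.

(** * Coordinates *)

Lemma eq_coord (c c' : cochain F) :
  (forall (u : seq 'I_3) (g : 'I_3), u \in subs -> g \in ords ->
     c [set:: u] 0 g = c' [set:: u] 0 g) ->
  c = c'.
Proof.
move=> E; apply/ffunP => S; apply/rowP => g.
by have [u us ->] := set_sub S; apply: E; rewrite ?ords_in.
Qed.

Lemma homogeneous_coord k (c : cochain F) (u : seq 'I_3) (g : 'I_3) :
  homogeneous k c -> u \in subs -> size u != k -> c [set:: u] 0 g = 0.
Proof. by move=> ck us uk; rewrite ck ?mxE // cardE enum_sub. Qed.

(* The scalars of a combination must stay folded, so the integral coefficients
   are evaluated one at a time instead of by reducing the whole goal. *)
Ltac eval_coefl := repeat match goal with |- context [coefl ?l ?g ?u] =>
  let v := eval vm_compute in (coefl l g u) in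
  let E := fresh in
  (have E : coefl l g u = v by vm_compute);
  move: E; generalize (coefl l g u) => ? ->
  end.

(* Splits a goal [u \in subs -> g \in ords -> P u g] into its 24 instances. *)
Ltac case_coord :=
  rewrite /subs /ords !inE;
  move=> /or4P[|||/or4P[|||/orP[]]] /eqP-> /or3P[] /eqP->.

Lemma bindl1 f al s : bindl f [:: (1, al, s)] = f al s.
Proof.
rewrite /bindl /= cats0 /scl map_id_in // => -[[k g] u] _ /=.
by rewrite mul1r.
Qed.

(** The nonzero entries of one row of the matrix of the differential in the
    monomial basis: each term lists an entry and the monomial of its column. *)
Definition CEdiff_row eps (u : seq 'I_3) (g : 'I_3) : seq term :=
  [seq t <- [seq (coefl (dL eps al s) g u, al, s) | s <- subs, al <- ords]
  | t.1.1 != 0].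

Lemma CEdiff_coord eps (c : cochain F) u g :
  CEdiff eps c [set:: u] 0 g =
  \sum_(t <- CEdiff_row eps u g) t.1.1%:~R * c [set:: t.2] 0 t.1.2.
Proof.
have {1}-> : c =
    comb [seq (c [set:: s] 0 al, [:: (1, al, s)]) | s <- subs, al <- ords].
  apply: eq_coord => v h; rewrite comb_coord big_allpairs_dep /=.
  by rewrite !big_cons !big_nil; case_coord; eval_coefl; ring.
rewrite CEdiff_comb comb_coord big_map /CEdiff_row big_filter [RHS]big_mkcond.
rewrite !big_allpairs_dep.
apply: eq_bigr => s _; apply: eq_bigr => al _; rewrite bindl1 mulrC.
by case: eqP => //= ->; rewrite mul0r.
Qed.

Ltac expand_CEdiff := rewrite CEdiff_coord;
  match goal with |- context [CEdiff_row ?eps ?u ?g] =>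
    let l := eval vm_compute in (CEdiff_row eps u g) in
    rewrite (_ : CEdiff_row eps u g = l); last by vm_compute
  end; rewrite ?big_cons big_nil /=.

(** In degrees 1 and 3 coboundaries take their values in the centre of n: an
    inner derivation maps n to [n, n], and in top degree the terms e (x) d(omega)
    vanish because every 2-form on n is closed. *)
Lemma CEdiff_offcenter eps (c : cochain F) u g :
  u \in [:: [:: r10]; [:: r01]; [:: r11]; [:: r10; r01; r11]] ->
  g \in [:: r10; r01] -> CEdiff eps c [set:: u] 0 g = 0.
Proof.
by rewrite !inE => /or4P[] /eqP-> /orP[] /eqP->; case: eps; expand_CEdiff.
Qed.

Lemma CEdiff_deg0 eps (c : cochain F) :
  CEdiff eps c [set:: [:: r10]] 0 r11 = (-1) ^+ eps * c [set:: [::]] 0 r01 /\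
  CEdiff eps c [set:: [:: r01]] 0 r11 = - (-1) ^+ eps * c [set:: [::]] 0 r10.
Proof. by split; case: eps; expand_CEdiff; ring. Qed.

Lemma CEdiff_deg2 eps (c : cochain F) :
  CEdiff eps c [set:: [:: r10; r01; r11]] 0 r11 =
  (-1) ^+ eps * (c [set:: [:: r01; r11]] 0 r01 + c [set:: [:: r10; r11]] 0 r10).
Proof. by case: eps; expand_CEdiff; ring. Qed.

(** * The square of an odd cocycle *)

(** The basis cocycles with f^01 /\ f^10 rewritten as - f^10 /\ f^01, so that
    only increasing sequences occur. *)
Definition hterms (a0 a b c d k : F) : seq (F * seq term) :=
  [:: (a0, [:: (1, r11, [::])]);
      (a, [:: (1, r01, [:: r10; r11])]);
      (b, [:: (-1, r01, [:: r01; r11]); (1, r10, [:: r10; r11])]);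
      (c, [:: (-1, r01, [:: r10; r01]); (-1, r11, [:: r10; r11])]);
      (d, [:: (1, r10, [:: r01; r11])]);
      (k, [:: (-1, r10, [:: r10; r01]); (1, r11, [:: r01; r11])])].

Lemma on_subs_hterms a0 a b c d k :
  all on_subs (unzip2 (hterms a0 a b c d k)).
Proof. by vm_compute. Qed.

#[local] Arguments lbr : simpl never.
#[local] Arguments coefl : simpl never.
#[local] Arguments bindl : simpl never.

Lemma bracket_square (a0 a b c d k : F) :
  bracket (comb (hterms a0 a b c d k)) (comb (hterms a0 a b c d k)) =
  comb [:: (2 * a0 * a, [:: (1, r01, [:: r10])]);
           (2 * a0 * b, [:: (-1, r01, [:: r01]); (1, r10, [:: r10])]);
           (- 2 * a0 * c, [:: (1, r11, [:: r10])]);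
           (2 * a0 * d, [:: (1, r10, [:: r01])]);
           (2 * a0 * k, [:: (1, r11, [:: r01])]);
           (4 * (a * k - b * c), [:: (1, r01, [:: r10; r01; r11])]);
           (4 * (b * k + c * d), [:: (1, r10, [:: r10; r01; r11])])].
Proof.
rewrite bracket_comb ?on_subs_hterms //; apply: eq_coord => u g.
rewrite !comb_coord big_allpairs_dep /hterms !big_cons !big_nil /=.
by case_coord; eval_coefl; ring.
Qed.

(** * Cocycles of degree 0 and 2 *)

Hypothesis two_neq0 : (2 : F) != 0.
Variable eps : bool.
Notation sg := ((-1) ^+ eps : F).

Lemma cocycle0_span (z : cochain F) : z \in cocycles F eps -> homogeneous 0 z ->
  z = comb (hterms (z [set:: [::]] 0 r11) 0 0 0 0 0).
Proof.
move=> /cocycleP dz z0.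
have [] := CEdiff_deg0 eps z; rewrite dz !ffunE !mxE.
move/esym/eqP; rewrite mulf_eq0 signr_eq0 /= => /eqP z01.
move/esym/eqP; rewrite mulf_eq0 oppr_eq0 signr_eq0 /= => /eqP z10.
apply: eq_coord => u g us gE; have zu0 := homogeneous_coord g z0 us.
rewrite comb_coord !big_cons big_nil /=; move: us gE zu0.
by case_coord => zu0; rewrite ?z01 ?z10; try (rewrite zu0; last by []);
  eval_coefl; ring.
Qed.

Lemma sum_diff (x y : F) : exists k l : F, x = l + k /\ y = l - k.
Proof. by exists ((x - y) / 2), ((x + y) / 2); split; field. Qed.

(* Coordinates are turned into variables before ring is called: recognizing
   them as atoms is much slower. *)
Ltac abstract_coords := repeat match goal with
  |- context [fun_of_matrix (fun_of_fin ?z ?S) ?i ?j] =>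
    let x := fresh "x" in move: (fun_of_matrix (fun_of_fin z S) i j) => x
  end.

Lemma cocycle2_span (z : cochain F) : z \in cocycles F eps -> homogeneous 2 z ->
  exists a b c d k f, z = comb (hterms 0 a b c d k) + CEdiff eps f.
Proof.
move=> /cocycleP dz z2.
have := CEdiff_deg2 eps z; rewrite dz !ffunE !mxE.
move/esym/eqP; rewrite mulf_eq0 signr_eq0 /= addr_eq0 => /eqP z01.
(* The plane of e_10 (x) f^10 /\ f^01 and e_11 (x) f^01 /\ f^11 is spanned by
   h2_5, along which the coordinates are opposite, and by the coboundary of
   e_10 (x) f^11, along which they are equal. On e_01 (x) f^10 /\ f^01
   and e_11 (x) f^10 /\ f^11 the same holds, with equal and opposite exchanged,
   for h2_3 and the coboundary of e_01 (x) f^11. The coboundary of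
   e_11 (x) f^11 removes e_11 (x) f^10 /\ f^01. *)
have [k [l [r11E p10E]]] :=
  sum_diff (z [set:: [:: r01; r11]] 0 r11) (z [set:: [:: r10; r01]] 0 r10).
have [m [c [q11E p01E]]] :=
  sum_diff (z [set:: [:: r10; r11]] 0 r11) (z [set:: [:: r10; r01]] 0 r01).
exists (z [set:: [:: r10; r11]] 0 r01), (z [set:: [:: r10; r11]] 0 r10), (- c).
exists (z [set:: [:: r01; r11]] 0 r10), k.
exists (comb
  [:: (- sg * z [set:: [:: r10; r01]] 0 r11, [:: (1, r11, [:: r11])]);
      (- sg * l, [:: (1, r10, [:: r11])]); (sg * m, [:: (1, r01, [:: r11])])]).
rewrite CEdiff_comb -comb_cat; apply: eq_coord => u g us gE.
have zu0 := homogeneous_coord g z2 us.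
rewrite comb_coord !big_cons big_nil /=; move: us gE zu0.
case_coord => zu0; rewrite ?r11E ?p10E ?q11E ?p01E ?z01;
  try (rewrite zu0; last by []).
all: clear; abstract_coords; case: eps; eval_coefl; ring.
Qed.

(** * Homologic classes *)

Definition hclass (a0 a b c d k : F) : cohomology F eps :=
  a0 *: h0_1 + (a *: h2_1 + b *: h2_2 + c *: h2_3 + d *: h2_4 + k *: h2_5).

Lemma hclassE a0 a b c d k : exists2 z : subvs_of (cocycles F eps),
  vsval z = comb (hterms a0 a b c d k) & hclass a0 a b c d k = cls z.
Proof.
eexists; last by rewrite /hclass -!linearZ -!linearD; reflexivity.
rewrite !linearD !linearZ /= /z0_1 /z2_1 /z2_2 /z2_3 /z2_4 /z2_5.
have m1 al s : lin F [:: (1, al, s)] = monomial F al s.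
  by rewrite /lin big_seq1 scale1r.
have mN al s : lin F [:: (-1, al, s)] = - monomial F al s.
  by rewrite /lin big_seq1 /= mulrN1z scaleN1r.
have swap al : monomial F al [:: r01; r10] = - monomial F al [:: r10; r01].
  rewrite -m1 -mN; apply: eq_coord => u g; rewrite !coeflE.
  by case_coord; have := ords_in al; rewrite /ords !inE;
    move=> /or3P[] /eqP->; eval_coefl.
rewrite !comb_cons comb_nil /= !(lin_cat _ [:: _] [:: _]) !m1 !mN !swap addr0.
by rewrite !addrA.
Qed.

Lemma H0_span (x : cohomology F eps) : in_H 0 x -> exists a0, x = a0 *: h0_1.
Proof.
move=> [z z0 ->]; have zE := cocycle0_span (subvsP z) z0.
exists (vsval z [set:: [::]] 0 r11).
have [w wE hE] := hclassE (vsval z [set:: [::]] 0 r11) 0 0 0 0 0.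
transitivity (hclass (vsval z [set:: [::]] 0 r11) 0 0 0 0 0).
  by rewrite hE; congr cls; apply: val_inj; rewrite /= wE.
by rewrite /hclass !scale0r !addr0.
Qed.

Lemma H2_span (x : cohomology F eps) : in_H 2 x -> exists a b c d k,
  x = a *: h2_1 + b *: h2_2 + c *: h2_3 + d *: h2_4 + k *: h2_5.
Proof.
move=> [z z2 ->].
have [a [b [c [d [k [f zE]]]]]] := cocycle2_span (subvsP z) z2.
exists a, b, c, d, k; have [w wE hE] := hclassE 0 a b c d k.
transitivity (hclass 0 a b c d k); last by rewrite /hclass scale0r add0r.
rewrite hE; apply/clsP/coboundaryP; exists f.
by rewrite linearB /= wE zE addrC addKr.
Qed.

Lemma homologicP (z : subvs_of (cocycles F eps)) :
  homologic (cls z) <-> exists f, bracket (vsval z) (vsval z) = CEdiff eps f.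
Proof.
rewrite /homologic lbracket_cls -[X in _ = X](raddf0 (@cls F eps)).
by split=> [/clsP/coboundaryP|E]; last apply/clsP/coboundaryP; rewrite subr0.
Qed.

Lemma homologic_hclass a0 a b c d k :
  homologic (hclass a0 a b c d k) <->
  [/\ a0 * a = 0, a0 * b = 0, a0 * d = 0, a * k - b * c = 0 & b * k + c * d = 0].
Proof.
have [z zE ->] := hclassE a0 a b c d k.
rewrite homologicP zE bracket_square.
have four_neq0 : (4 : F) != 0.
  by rewrite (_ : 4 = 2 * 2) ?mulf_neq0 //; ring.
split=> [[f fE]|[a0a a0b a0d r1 r2]].
  have coord u g uE gE := etrans
    (congr1 (fun x : cochain F => x [set:: u] 0 g) fE)
    (CEdiff_offcenter eps f uE gE).
  have := (coord [:: r10] r01 isT isT, coord [:: r10] r10 isT isT,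
    coord [:: r01] r10 isT isT, coord [:: r10; r01; r11] r01 isT isT,
    coord [:: r10; r01; r11] r10 isT isT).
  rewrite !comb_coord !big_cons !big_nil /=; eval_coefl.
  rewrite !(mulr0, mulr1, addr0, add0r) -!mulrA.
  case=> [[[[E1 E2] E3] E4] E5].
  by split; [apply: (mulfI two_neq0)|apply: (mulfI two_neq0)|
    apply: (mulfI two_neq0)|apply: (mulfI four_neq0)|apply: (mulfI four_neq0)];
    rewrite mulr0.
(* What remains of the square is the coboundary of an element of n. *)
exists (comb [:: (- 2 * a0 * c * sg, [:: (1, r01, [::])]);
                 (- 2 * a0 * k * sg, [:: (1, r10, [::])])]).
rewrite CEdiff_comb r1 r2 -!mulrA a0a a0b a0d; apply: eq_coord => u g.
rewrite !comb_coord !big_cons !big_nil /=.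
by case_coord; case: eps; eval_coefl; ring.
Qed.

End HomologicElements.

Theorem mainTheorem8 (R : realType) (eps : bool)
    (x0 x2 : cohomology R[i] eps) (x0_deg : in_H 0 x0) (x2_deg : in_H 2 x2) :
  homologic (x0 + x2) <->
    (x0 <> 0 /\
     exists a b c : R[i], a <> 0 /\
       x0 + x2 = a *: h0_1 + b *: h2_3 + c *: h2_5)
    \/
    (x0 = 0 /\
     exists a b c d e : R[i],
       [/\ x0 + x2 = a *: h2_1 + b *: h2_2 + c *: h2_3 + d *: h2_4 + e *: h2_5,
           a * e - b * c = 0 & b * e + c * d = 0]).
Proof.
have two_neq0 : (2 : R[i]) != 0 by rewrite pnatr_eq0.
split=> [hx|[[_ [a [b [c [_ ->]]]]]|[_ [a [b [c [d [k [-> r1 r2]]]]]]]]].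
- have [a0 x0E] := H0_span x0_deg.
  have [a [b [c [d [k x2E]]]]] := H2_span two_neq0 x2_deg.
  have xE : x0 + x2 = hclass eps a0 a b c d k by rewrite /hclass -x2E -x0E.
  have [x00|x0n0] := x0 =P 0.
    right; split=> //; exists a, b, c, d, k.
    have xE0 : x0 + x2 = hclass eps 0 a b c d k.
      by rewrite x00 x2E /hclass scale0r.
    move: hx; rewrite xE0 homologic_hclass // => -[_ _ _ r1 r2].
    by split=> //; rewrite /hclass scale0r add0r.
  left; split=> //; exists a0, c, k.
  have a0n0 : a0 != 0 by apply/eqP => E; apply: x0n0; rewrite x0E E scale0r.
  move: hx; rewrite xE homologic_hclass // => -[a0a a0b a0d _ _].
  have z t : a0 * t = 0 -> t = 0 by rewrite -{1}(mulr0 a0); exact: mulfI.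
  rewrite (z _ a0a) (z _ a0b) (z _ a0d) /hclass !scale0r !add0r addr0 addrA.
  by split=> //; apply/eqP.
- have -> : a *: h0_1 + b *: h2_3 + c *: h2_5 = hclass eps a 0 0 b 0 c.
    by rewrite /hclass !scale0r !add0r addr0 addrA.
  by rewrite homologic_hclass // !(mulr0, mul0r) subr0 addr0.
have -> : a *: h2_1 + b *: h2_2 + c *: h2_3 + d *: h2_4 + k *: h2_5 =
    hclass eps 0 a b c d k by rewrite /hclass scale0r add0r.
by rewrite homologic_hclass // !mul0r.
Qed.
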